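(* Let $(H,\langle\cdot,\cdot\rangle_H,\|\cdot\|_H)$ be a real Hilbert space, let $S_H=\{x\in H:\|x\|_H=1\}$ be its unit sphere, and let $n\ge2$. Then $$d(x_1,\ldots,x_n)=\|x_1\wedge\cdots\wedge x_n\|_\wedge=\Big(\det\big(\langle x_i,x_j\rangle_H\big)_{i,j=1}^n\Big)^{1/2},\qquad x_1,\ldots,x_n\in S_H,$$ defines a pseudo $n$-metric on $S_H$.
   Context: Here $\|\cdot\|_\wedge$ is the norm on the $n$-fold exterior product $\bigwedge^nH$ induced by the inner product determined by $\langle x_1\wedge\cdots\wedge x_n,y_1\wedge\cdots\wedge y_n\rangle=\det(\langle x_i,y_j\rangle_H)_{i,j=1}^n$; thus the second equality in the definition of $d$ is the definition of this norm on elementary exterior products. For $n\ge2$ and a set $X$, a map $d:X^n\to\mathbb{R}$ is a pseudo $n$-metric on $X$ if (i) $d(x_1,\ldots,x_n)=0$ whenever $x_i=x_j$ for some $i\ne j$; (ii) $d(x_{\pi(1)},\ldots,x_{\pi(n)})=d(x_1,\ldots,x_n)$ for all permutations $\pi$ of $\{1,\ldots,n\}$; (iii) $d(x_1,\ldots,x_n)\le\sum_{i=1}^n d(x_1,\ldots,x_{i-1},y,x_{i+1},\ldots,x_n)$ for all $x_1,\ldots,x_n,y\in X$. *)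

(* Defs.v *)
From HB Require Import structures.
From mathcomp Require Import all_boot all_order all_algebra all_fingroup.
From mathcomp Require Import generic_quotient ring_quotient sesquilinear.
From mathcomp Require Import all_classical all_reals all_analysis.
From mathcomp Require freeg.

Set Implicit Arguments.
Unset Strict Implicit.
Unset Printing Implicit Defensive.

Import Order.TTheory GRing.Theory Num.Theory.
Import numFieldNormedType.Exports.
Import freeg.

Local Open Scope quotient_scope.
Local Open Scope classical_set_scope.
Local Open Scope ring_scope.

Definition replace (n : nat) (X : Type) (x : 'I_n -> X) (i : 'I_n) (y : X) :
    'I_n -> X :=
  fun j => if j == i then y else x j.

Definition pseudo_nmetric (R : realType) (n : nat) (X : Type)
    (d : ('I_n -> X) -> R) : Prop :=
  [/\ forall (x : 'I_n -> X) (i j : 'I_n), i != j -> x i = x j -> d x = 0,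
      forall (x : 'I_n -> X) (s : 'S_n), d (fun i => x (s i)) = d x
    & forall (x : 'I_n -> X) (y : X), d x <= \sum_(i < n) d (replace x i y)].

Definition unit_sphere (R : realType) (H : normedModType R) : set H :=
  [set x | `|x| = 1].
Arguments unit_sphere {R} H.

(* The norm of H is the one induced by the inner product [ip]; together with
   [completeNormedModType] this makes H a real Hilbert space. *)
Definition norm_induced_by (R : realType) (H : normedModType R)
    (ip : {dot H for idfun}) : Prop :=
  forall x : H, `|x| = Num.sqrt (ip x x).

Section ExteriorPower.
Variables (R : realType) (H : lmodType R) (n : nat).

(* The free R-module on H^n. *)
Definition formal_wedges : lmodType R := {freeg {ffun 'I_n -> H} / R}.

Definition formal_wedge (x : 'I_n -> H) : formal_wedges :=
  [freeg [:: (1, [ffun i => x i])]].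

Definition is_submodule (S : set formal_wedges) : Prop :=
  S 0 /\ forall (a : R) (p q : formal_wedges), S p -> S q -> S (a *: p + q).

Definition has_wedge_relations (S : set formal_wedges) : Prop :=
  (forall (x : 'I_n -> H) (i : 'I_n) (a : R) (u v : H),
     S (formal_wedge (replace x i (a *: u + v))
        - (a *: formal_wedge (replace x i u) + formal_wedge (replace x i v))))
  /\ (forall (x : 'I_n -> H) (i j : 'I_n),
        i != j -> x i = x j -> S (formal_wedge x)).

(* The submodule generated by the multilinearity and alternation relations. *)
Definition wedge_relations : {pred formal_wedges} :=
  fun p => `[< forall S, is_submodule S -> has_wedge_relations S -> S p >].

Fact wedge_relations_linear (a : R) (p q : formal_wedges) :
  p \in wedge_relations -> q \in wedge_relations ->
  a *: p + q \in wedge_relations.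
Proof.
move=> /asboolP hp /asboolP hq; apply/asboolP => S sS rS.
by apply: sS.2; [exact: hp | exact: hq].
Qed.

Fact wedge_relations_zmod_closed : zmod_closed wedge_relations.
Proof.
split=> [|p q hp hq]; first by apply/asboolP => S [].
by rewrite addrC -scaleN1r wedge_relations_linear.
Qed.

HB.instance Definition _ :=
  GRing.isZmodClosed.Build formal_wedges wedge_relations
    wedge_relations_zmod_closed.

Definition exterior_power : Type :=
  Quotient.quot (wedge_relations : zmodClosed formal_wedges).

HB.instance Definition _ := GRing.Zmodule.on exterior_power.
HB.instance Definition _ := EqQuotient.on exterior_power.
HB.instance Definition _ := ZmodQuotient.on exterior_power.

Lemma exterior_power_eqP (p q : formal_wedges) :
  reflect (p = q %[mod exterior_power]) (p - q \in wedge_relations).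
Proof.
rewrite (Quotient.idealrBE (wedge_relations : zmodClosed formal_wedges)).
by apply: (iffP eqP).
Qed.

Definition exterior_scale (a : R) (u : exterior_power) : exterior_power :=
  \pi_exterior_power (a *: repr u).

Lemma pi_exterior_scale (a : R) (p : formal_wedges) :
  exterior_scale a (\pi_exterior_power p) = \pi_exterior_power (a *: p).
Proof.
apply/exterior_power_eqP; rewrite -scalerBr -[_ *: _]addr0.
apply: wedge_relations_linear; last exact: rpred0.
by apply/exterior_power_eqP; rewrite reprK.
Qed.

Fact exterior_scaleA a b u :
  exterior_scale a (exterior_scale b u) = exterior_scale (a * b) u.
Proof.
by elim/quotW: u => p; rewrite (pi_exterior_scale b) 2!pi_exterior_scale scalerA.
Qed.

Fact exterior_scale1 : left_id 1 exterior_scale.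
Proof. by elim/quotW=> p; rewrite pi_exterior_scale scale1r. Qed.

Fact exterior_scaleDr : right_distributive exterior_scale +%R.
Proof.
move=> a; elim/quotW=> p; elim/quotW=> q; rewrite -raddfD 3!pi_exterior_scale.
by rewrite -raddfD scalerDr.
Qed.

Fact exterior_scaleDl u : {morph exterior_scale^~ u : a b / a + b}.
Proof.
by move=> a b; elim/quotW: u => p; rewrite 3!pi_exterior_scale -raddfD scalerDl.
Qed.

HB.instance Definition _ := GRing.Zmodule_isLmodule.Build R exterior_power
  exterior_scaleA exterior_scale1 exterior_scaleDr exterior_scaleDl.

Definition wedge (x : 'I_n -> H) : exterior_power :=
  \pi_exterior_power (formal_wedge x).

End ExteriorPower.
Arguments wedge_relations {R} H n.

Section FormalLift.
Variables (R : nzRingType) (K : choiceType) (M : lmodType R) (f : K -> M).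

HB.instance Definition _ := GRing.isZmodMorphism.Build {freeg K / R} M
  (fglift f) (lift_is_additive f).

Fact fglift_scalable : scalable (fglift f : {freeg K / R} -> M).
Proof.
move=> a p.
have -> : a *: p = \sum_(x <- dom p) << a * coeff x p *g x >> by [].
rewrite (raddf_sum (fglift f)) -[in RHS](freeg_sumE p).
rewrite [in RHS](raddf_sum (fglift f)) scaler_sumr.
by apply: eq_bigr => x _ /=; rewrite !liftU scalerA.
Qed.

HB.instance Definition _ := GRing.isScalable.Build R {freeg K / R} M *:%R
  (fglift f) fglift_scalable.

End FormalLift.

Section ExteriorNorm.
Variables (R : realType) (H : lmodType R) (ip : {dot H for idfun}) (n : nat).

Definition gram_det (x y : 'I_n -> H) : R :=
  \det (\matrix_(i < n, j < n) ip (x i) (y j)).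

(* The bilinear extension of [gram_det] to formal sums. *)
Definition formal_inner (p q : formal_wedges H n) : R :=
  fglift (fun x : {ffun 'I_n -> H} =>
    fglift (fun y : {ffun 'I_n -> H} => gram_det x y : R^o) q : R^o) p.

(* Independent of the representatives, see [exterior_inner_pi] below. *)
Definition exterior_inner (u v : exterior_power H n) : R :=
  formal_inner (repr u) (repr v).

Lemma gram_detC (x y : 'I_n -> H) : gram_det x y = gram_det y x.
Proof.
rewrite /gram_det -det_tr; congr (\det _); apply/matrixP => i j; rewrite !mxE.
by rewrite (hermitian_subproof (x j)) expr0 mul1r.
Qed.

Lemma gram_det_replaceD (x y : 'I_n -> H) i a u v :
  gram_det (replace x i (a *: u + v)) y =
  a * gram_det (replace x i u) y + gram_det (replace x i v) y.
Proof.
rewrite -[gram_det (replace x i v) y]mul1r /gram_det.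
apply: (@determinant_multilinear _ _ _
  (\matrix_(k < n, j < n) ip (replace x i u k) (y j))
  (\matrix_(k < n, j < n) ip (replace x i v k) (y j)) i a 1).
- apply/rowP => j; rewrite !mxE /replace eqxx mul1r.
  by rewrite linearDl linearZl_LR.
- apply/matrixP => k j; rewrite !mxE /replace.
  by rewrite eq_sym (negbTE (neq_lift _ _)).
- apply/matrixP => k j; rewrite !mxE /replace.
  by rewrite eq_sym (negbTE (neq_lift _ _)).
Qed.

Lemma gram_det_alternate (x y : 'I_n -> H) i j :
  i != j -> x i = x j -> gram_det x y = 0.
Proof.
move=> ij xij; apply: (determinant_alternate ij) => k.
by rewrite !mxE xij.
Qed.

Lemma formal_innerE p q : formal_inner p q =
  \sum_(kx <- repr p) \sum_(ly <- repr q) kx.1 * (ly.1 * gram_det kx.2 ly.2).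
Proof.
rewrite /formal_inner; unlock fglift; rewrite /lift /prelift.
by apply: eq_bigr => kx _; rewrite -mulr_sumr.
Qed.

Lemma formal_innerC p q : formal_inner p q = formal_inner q p.
Proof.
rewrite !formal_innerE exchange_big /=; apply: eq_bigr => ly _.
by apply: eq_bigr => kx _; rewrite gram_detC mulrCA.
Qed.

Lemma formal_inner_wedge x y :
  formal_inner (formal_wedge x) (formal_wedge y) = gram_det x y.
Proof.
rewrite /formal_inner !liftU !scale1r.
by congr gram_det; apply/funext => i; rewrite ffunE.
Qed.

Lemma formal_inner_wedgel x q : formal_inner (formal_wedge x) q =
  \sum_(ly <- repr q) ly.1 * gram_det x ly.2.
Proof.
rewrite /formal_inner liftU scale1r; unlock fglift; rewrite /lift /prelift.
apply: eq_bigr => ly _; congr (_ * gram_det _ _).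
by apply/funext => i; rewrite ffunE.
Qed.

Lemma formal_inner_linear q a p p' :
  formal_inner (a *: p + p') q = a * formal_inner p q + formal_inner p' q.
Proof. by rewrite /formal_inner linearP. Qed.

Lemma formal_innerBl q p p' :
  formal_inner (p - p') q = formal_inner p q - formal_inner p' q.
Proof. by rewrite /formal_inner raddfB. Qed.

Lemma formal_inner_relations p q :
  p \in wedge_relations H n -> formal_inner p q = 0.
Proof.
move=> /asboolP /(_ [set r | formal_inner r q = 0]); apply.
split=> [|a p1 p2 /= h1 h2] /=.
- by rewrite /formal_inner raddf0.
- by rewrite formal_inner_linear h1 h2 mulr0 addr0.
split=> [x i a u v|x i j ij xij] /=.
- rewrite formal_innerBl formal_inner_linear !formal_inner_wedgel.
  rewrite mulr_sumr -big_split /= -sumrB big1 // => ly _.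
  by rewrite gram_det_replaceD mulrDr mulrCA subrr.
- rewrite formal_inner_wedgel big1 // => ly _.
  by rewrite (gram_det_alternate _ ij xij) mulr0.
Qed.

Lemma exterior_inner_pi (p q : formal_wedges H n) :
  exterior_inner (\pi_(exterior_power H n) p) (\pi_(exterior_power H n) q)
  = formal_inner p q.
Proof.
have eqv r s t : r = s %[mod exterior_power H n] ->
    formal_inner r t = formal_inner s t.
  move=> /exterior_power_eqP rs; apply/eqP; rewrite -subr_eq0 -formal_innerBl.
  by rewrite formal_inner_relations.
rewrite /exterior_inner (eqv _ p) ?reprK // formal_innerC (eqv _ q) ?reprK //.
exact: formal_innerC.
Qed.

Lemma exterior_inner_wedge (x y : 'I_n -> H) :
  exterior_inner (wedge x) (wedge y) = gram_det x y.
Proof. by rewrite exterior_inner_pi formal_inner_wedge. Qed.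

Definition exterior_norm (u : exterior_power H n) : R :=
  Num.sqrt (exterior_inner u u).

End ExteriorNorm.

Definition sphere_nmetric (R : realType) (H : normedModType R)
    (ip : {dot H for idfun}) (n : nat) (x : 'I_n -> unit_sphere H) : R :=
  exterior_norm ip (wedge (fun i => \val (x i))).

(* Main.v *)
Require Import Defs.
From mathcomp Require Import all_boot all_order all_algebra all_fingroup.
From mathcomp Require Import sesquilinear.
From mathcomp Require Import all_classical all_reals all_analysis.
From mathcomp Require Import ring lra.

Import Order.TTheory GRing.Theory Num.Theory.
Import numFieldNormedType.Exports.

Local Open Scope classical_set_scope.
Local Open Scope ring_scope.

(** For the simplex inequality let D be the Gram determinant of unit vectors
    x_1, ..., x_n; only D > 0 matters. Write y = sum_j a_j x_j + w with w
    orthogonal to all x_j. Then the Gram determinant D_i of the family with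
    x_i replaced by y is a_i^2 D + |w|^2 C_i, where C_i is the i-th diagonal
    cofactor. The vector u_i dual to x_i satisfies C_i = |u_i|^2 D, and
    <u_i, x_i> = 1 with |x_i| = 1 forces |u_i| >= 1; hence
    D_i >= (a_i^2 + |w|^2) D. Finally
    sum_i (a_i^2 + |w|^2)^(1/2) >= ((sum_i |a_i|)^2 + |w|^2)^(1/2) >= |y| = 1. *)

(** Only the summand at [i0] has to use its [c]; every other root is just bounded below by [|a i|].
    From s^2 = t^2 + c, t <= s and B <= B' follows (t + B)^2 + c = s^2 + 2tB + B^2 <= (s + B')^2.
    The index [i0] rules out the empty sum. *)
Lemma sqr_sum_norm_le_sum_sqrt (R : rcfType) (I : finType) (a : I -> R)
    (c : R) (i0 : I) :
  0 <= c ->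
  (\sum_i `|a i|) ^+ 2 + c <= (\sum_i Num.sqrt (a i ^+ 2 + c)) ^+ 2.
Proof.
move=> c0.
have le_sqrt i : `|a i| <= Num.sqrt (a i ^+ 2 + c).
  by rewrite -sqrtr_sqr ler_wsqrtr // lerDl.
rewrite (bigD1 i0) //= [X in _ <= X ^+ 2](bigD1 i0) //=.
set B := \sum_(i | _) `|a i|; set B' := \sum_(i | _) Num.sqrt _.
have B0 : 0 <= B by apply: sumr_ge0.
have BB' : B <= B' by apply: ler_sum.
have := le_sqrt i0; have := normr_ge0 (a i0).
have := sqr_sqrtr (addr_ge0 (sqr_ge0 (a i0)) c0); have := real_normK (num_real (a i0)).
set s := Num.sqrt _; set t := `|a i0|; nra.
Qed.

Section RealInnerProduct.
Variables (R : realType) (H : lmodType R) (ip : {dot H for idfun}).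

Lemma ipC (u v : H) : ip u v = ip v u.
Proof. by rewrite hermitian_subproof expr0 mul1r. Qed.

Lemma ip_ge0 (u : H) : 0 <= ip u u.
Proof.
have [->|u0] := eqVneq u 0; first by rewrite linear0l.
by rewrite ltW // neq0_dnorm_gt0.
Qed.

Lemma ip_sqrD (a : R) (u v : H) :
  ip (a *: u + v) (a *: u + v) = a ^+ 2 * ip u u + 2 * a * ip u v + ip v v.
Proof.
rewrite linearDl linearZl_LR !linearD !linearZ /= (ipC v u); ring.
Qed.

Lemma ip_suml (I : finType) (a : I -> R) (x : I -> H) (v : H) :
  ip (\sum_i a i *: x i) v = \sum_i a i * ip (x i) v.
Proof.
have ipD : {morph ip^~ v : u1 u2 / u1 + u2} by move=> ? ? /=; rewrite linearDl.
rewrite (big_morph (ip^~ v) ipD (linear0l ip v)).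
by apply: eq_bigr => i _; rewrite linearZl_LR.
Qed.

(** Cauchy-Schwarz for unit vectors, read off from |v + u|^2 >= 0 and |v - u|^2 >= 0. *)
Lemma ip_unit_le1 (u v : H) : ip u u = 1 -> ip v v = 1 -> `|ip u v| <= 1.
Proof.
move=> u1 v1; have := ip_ge0 (1 *: u + v); have := ip_ge0 ((-1) *: u + v).
by rewrite !ip_sqrD u1 v1 ler_norml; lra.
Qed.

Lemma ip_sum_unit_le (I : finType) (a : I -> R) (x : I -> H) :
  (forall i, ip (x i) (x i) = 1) ->
  ip (\sum_i a i *: x i) (\sum_i a i *: x i) <= (\sum_i `|a i|) ^+ 2.
Proof.
move=> x1; rewrite ip_suml expr2 mulr_suml; apply: ler_sum => i _.
rewrite ipC ip_suml mulr_sumr mulr_sumr; apply: ler_sum => j _.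
apply: le_trans (ler_norm _) _; rewrite !normrM mulrA ler_piMr ?mulr_ge0 //.
exact: ip_unit_le1.
Qed.

Section GramDeterminant.
Variables (n : nat).
Implicit Types x y : 'I_n -> H.

(** The sign is (-1)^(i+i) = 1, so this is the Gram determinant of the family with [x i] removed. *)
Definition gram_cofactor x (i : 'I_n) : R :=
  cofactor (\matrix_(k < n, l < n) ip (x k) (x l)) i i.

Lemma replace_eq x i v : replace x i v i = v.
Proof. by rewrite /replace eqxx. Qed.

Lemma replace_neq x i v j : j != i -> replace x i v j = x j.
Proof. by rewrite /replace => /negbTE ->. Qed.

Lemma replace_id x i : replace x i (x i) = x.
Proof. by apply/funext => j; rewrite /replace; case: eqP => [->|]. Qed.

(** Rows and columns are permuted together, so the sign of [s] enters twice and cancels. *)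
Lemma gram_det_perm x (s : 'S_n) :
  gram_det ip (fun i => x (s i)) (fun i => x (s i)) = gram_det ip x x.
Proof.
rewrite /gram_det.
have -> : \matrix_(i < n, j < n) ip (x (s i)) (x (s j)) =
    row_perm s (col_perm s (\matrix_(i < n, j < n) ip (x i) (x j))).
  by apply/matrixP => i j; rewrite !mxE.
rewrite row_permE col_permE !det_mulmx !det_perm odd_permV.
by rewrite mulrCA -signr_addb addbb mulr1.
Qed.

(** By linearity in row i; a summand [x j] with j != i repeats row j and contributes nothing. *)
Lemma gram_det_replace_sum x y i (a : 'I_n -> R) w :
  gram_det ip (replace x i (\sum_j a j *: x j + w)) y =
  a i * gram_det ip x y + gram_det ip (replace x i w) y.
Proof.
transitivity (\sum_j a j * gram_det ip (replace x i (x j)) y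
              + gram_det ip (replace x i w) y).
  elim: (index_enum _) => [|j s IHs]; first by rewrite !big_nil !add0r.
  by rewrite !big_cons -!addrA gram_det_replaceD IHs.
rewrite (bigD1 i) //= replace_id big1 ?addr0 // => j ji.
rewrite (@gram_det_alternate _ _ _ _ _ _ i j) ?mulr0 1?eq_sym //.
by rewrite replace_eq replace_neq.
Qed.

(** Row i has only its diagonal entry left, so expand along it. Leaving [y i] free allows both
    [y = x] and a [y] that is itself [x] with its i-th vector replaced. *)
Lemma gram_det_replace_orthogonal x y i v :
  (forall k, k != i -> y k = x k) ->
  (forall k, k != i -> ip v (x k) = 0) ->
  gram_det ip (replace x i v) y = ip v (y i) * gram_cofactor x i.
Proof.
move=> yx vx; rewrite /gram_det (expand_det_row _ i) (bigD1 i) //= big1.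
  rewrite addr0 mxE replace_eq /gram_cofactor /cofactor; congr (_ * (_ * \det _)).
  apply/matrixP => k l; rewrite !mxE.
  by rewrite replace_neq 1?eq_sym ?neq_lift // yx // eq_sym neq_lift.
by move=> k ki; rewrite mxE replace_eq yx // vx // mul0r.
Qed.

(** Serves twice: a Kronecker delta as [b] gives a dual vector, and [b k = ip y (x k)] gives the
    orthogonal projection of [y] on the span. *)
Lemma gram_solve x (b : 'I_n -> R) :
  gram_det ip x x != 0 ->
  exists a : 'I_n -> R, forall k, ip (\sum_j a j *: x j) (x k) = b k.
Proof.
set G := \matrix_(i < n, j < n) ip (x i) (x j); move=> detG.
have uG : G \in unitmx by rewrite unitmxE unitfE.
pose c := (\row_j b j) *m invmx G.
exists (c 0) => k; have := mulmxKV uG (\row_j b j).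
move/rowP/(_ k); rewrite !mxE => <-; rewrite ip_suml.
by apply: eq_bigr => j _; rewrite [G j k]mxE.
Qed.

Lemma gram_cofactor_ge x i :
  ip (x i) (x i) = 1 -> 0 < gram_det ip x x ->
  gram_det ip x x <= gram_cofactor x i.
Proof.
move=> xi1 D0.
have [c cP] := gram_solve x (fun k => (k == i)%:R) (lt0r_neq0 D0).
set u := \sum_j c j *: x j in cP.
have uu : ip u u = c i.
  rewrite {1}/u ip_suml (bigD1 i) //= big1 => [|j ji].
    by rewrite ipC cP eqxx mulr1 addr0.
  by rewrite ipC cP (negbTE ji) mulr0.
have -> : gram_cofactor x i = ip u u * gram_det ip x x.
  have vx k : k != i -> ip u (x k) = 0 by rewrite cP => /negbTE ->.
  (* Compute the determinant with [u] in row i in two ways: orthogonality gives the cofactor, and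
     multilinearity gives [c i] times the Gram determinant, where [c i = ip u u]. *)
  have := gram_det_replace_orthogonal x x i u (fun _ _ => erefl) vx.
  rewrite cP eqxx mul1r => <-.
  have := gram_det_replace_sum x x i c 0; rewrite addr0 -/u => ->.
  rewrite gram_det_replace_orthogonal // => [|k _]; last by rewrite linear0l.
  by rewrite linear0l mul0r addr0 uu.
(* Expanding |x_i - u|^2 >= 0 with <u, x_i> = 1 yields |u|^2 >= 1. *)
rewrite ler_pMl //; have := ip_ge0 ((-1) *: u + x i).
by rewrite ip_sqrD cP eqxx mulr1n xi1; lra.
Qed.

Lemma gram_det_replace_self x i (a : 'I_n -> R) w :
  (forall k, ip w (x k) = 0) ->
  let z := replace x i (\sum_j a j *: x j + w) in
  gram_det ip z z =
  a i ^+ 2 * gram_det ip x x + ip w w * gram_cofactor x i.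
Proof.
(* Expand the first argument, then use symmetry to expand the second; the mixed term carries the
   factor [ip w (x i) = 0]. *)
move=> wx z; rewrite {1}/z gram_det_replace_sum gram_detC gram_det_replace_sum.
rewrite gram_det_replace_orthogonal ?wx //.
rewrite gram_det_replace_orthogonal // => [|k ki]; last first.
  by rewrite /z replace_neq.
rewrite /z replace_eq [ip w (_ + _)]linearD /= (ipC w (\sum_j _)) ip_suml big1.
  by rewrite /=; ring.
by move=> j _; rewrite ipC wx mulr0.
Qed.

Lemma gram_simplex x (y : H) :
  (0 < n)%N -> (forall i, ip (x i) (x i) = 1) -> ip y y = 1 ->
  Num.sqrt (gram_det ip x x) <=
  \sum_(i < n) Num.sqrt (gram_det ip (replace x i y) (replace x i y)).
Proof.
move=> n0 x1 y1; have [D0|D0] := leP (gram_det ip x x) 0.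
  (* [Num.sqrt] is 0 on nonpositive arguments. *)
  by rewrite ler0_sqrtr // sumr_ge0.
have [a aP] := gram_solve x (fun k => ip y (x k)) (lt0r_neq0 D0).
set p := \sum_j _ in aP; pose w := y - p.
have yE : y = p + w by rewrite /w addrC subrK.
have wx k : ip w (x k) = 0 by rewrite /w linearBl /= aP subrr.
have wp : ip p w = 0.
  by rewrite ip_suml big1 // => j _; rewrite ipC wx mulr0.
apply: (@le_trans _ _ (Num.sqrt (gram_det ip x x) *
                       \sum_i Num.sqrt (a i ^+ 2 + ip w w))).
  (* It remains to see that the sum of roots is at least 1; compare squares, using 1 = |p|^2 +
     |w|^2. *)
  rewrite ler_peMr // -(@ler_pXn2r _ 2) ?nnegrE ?sumr_ge0 // expr1n.
  apply: le_trans (sqr_sum_norm_le_sum_sqrt _ _ a _ (Ordinal n0) (ip_ge0 w)).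
  have := ip_sum_unit_le _ a x x1; rewrite -/p.
  by move: y1; rewrite yE -[p in LHS]scale1r ip_sqrD wp; lra.
rewrite mulr_sumr; apply: ler_sum => i _.
rewrite -sqrtrM ?(ltW D0) // ler_wsqrtr // yE gram_det_replace_self //.
rewrite mulrDr [_ * (a i ^+ 2)]mulrC lerD2l mulrC ler_wpM2l ?ip_ge0 //.
exact: gram_cofactor_ge.
Qed.

End GramDeterminant.
End RealInnerProduct.

Theorem proposition4p1 (R : realType) (H : completeNormedModType R)
    (ip : {dot H for idfun}) (norm_ip : norm_induced_by ip)
    (n : nat) (n_ge2 : (2 <= n)%N) :
  (forall x : 'I_n -> unit_sphere H,
     sphere_nmetric ip x =
     Num.sqrt (\det (\matrix_(i < n, j < n) ip (\val (x i)) (\val (x j)))))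
  /\ pseudo_nmetric (@sphere_nmetric R H ip n).
Proof.
have dE (x : 'I_n -> unit_sphere H) : sphere_nmetric ip x =
    Num.sqrt (gram_det ip (fun i => \val (x i)) (fun i => \val (x i))).
  by rewrite /sphere_nmetric /exterior_norm exterior_inner_wedge.
have sphere1 (x : unit_sphere H) : ip (\val x) (\val x) = 1.
  have : `|\val x| = 1 by have := valP x; rewrite inE.
  rewrite norm_ip => /(congr1 (fun r => r ^+ 2)).
  by rewrite sqr_sqrtr ?ip_ge0 // expr1n.
split=> [x|]; first exact: dE.
split=> [x i j ij xij|x s|x y]; rewrite !dE.
- by rewrite (gram_det_alternate _ _ ij) ?sqrtr0 // xij.
- by rewrite (gram_det_perm _ _ _ _ (fun i => \val (x i))).
- under eq_bigr => i _ do rewrite dE.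
  have := gram_simplex _ _ ip _ (fun i => \val (x i)) (\val y)
    (ltnW n_ge2) (fun i => sphere1 (x i)) (sphere1 y).
  move/le_trans; apply; apply: ler_sum => i _.
  (* Replacing an entry commutes with the inclusion of the sphere in [H]. *)
  suff -> : replace (fun j => \val (x j)) i (\val y) =
    (fun j => \val (replace x i y j)) by [].
  by apply/funext => j; rewrite /replace; case: eqP.
Qed.
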